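(* Let $r$ be a positive integer, $s$ a nonnegative integer, $k\in\mathbb Z$, $a_1,\dots,a_r$ nonzero complex numbers, and $\lambda\in\mathbb C$ with $\lambda\ne1$. Then for every integer $n\ge0$, $$S_n^{(r,k)}(x|a_1,\dots,a_r)=\sum_{m=0}^n\left(\frac{\binom{n}{m}}{(1-\lambda)^s}\sum_{j=0}^s\binom{s}{j}(-\lambda)^{s-j}S_{n-m}^{(r,k)}(j|a_1,\dots,a_r)\right)H_m^{(s)}(x|\lambda).$$
   Context: For an integer $k$, ${\rm Li}_k(x)=\sum_{m=1}^\infty x^m/m^k$. For $r\in\mathbb Z_{>0}$, $k\in\mathbb Z$ and nonzero complex $a_1,\dots,a_r$, the polynomials $S_n^{(r,k)}(x|a_1,\dots,a_r)$ are defined by $\frac{t^r}{\prod_{j=1}^r(e^{a_jt}-1)}\frac{{\rm Li}_k(1-e^{-t})}{1-e^{-t}}e^{xt}=\sum_{n\ge0}S_n^{(r,k)}(x|a_1,\dots,a_r)\frac{t^n}{n!}$. For $\lambda\ne1$, the Frobenius–Euler polynomials of order $s$ are defined by $\left(\frac{1-\lambda}{e^t-\lambda}\right)^se^{xt}=\sum_{n\ge0}H_n^{(s)}(x|\lambda)\frac{t^n}{n!}$. *)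

(* Defs.v *)
From HB Require Import structures.
From mathcomp Require Import all_boot all_order all_algebra.
From mathcomp Require Import complex.
From mathcomp Require Import boolp reals.

Set Implicit Arguments.
Unset Strict Implicit.
Unset Printing Implicit Defensive.

Import GRing.Theory.
Local Open Scope ring_scope.

(* Formal power series in t; [f n] is the coefficient of t^n. *)
Record fps (A : Type) := Fps { fps_coef :> nat -> A }.

Lemma fpsP (A : Type) (f g : fps A) : f =1 g -> f = g.
Proof. by case: f g => [f] [g] /= /funext ->. Qed.

HB.instance Definition _ (A : Type) := gen_eqMixin (fps A).
HB.instance Definition _ (A : Type) := gen_choiceMixin (fps A).

Section FpsZmod.
Variable A : zmodType.
Implicit Types f g h : fps A.

Definition fps_zero : fps A := Fps (fun _ => 0).
Definition fps_opp f : fps A := Fps (fun n => - f n).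
Definition fps_add f g : fps A := Fps (fun n => f n + g n).

Fact fps_addA : associative fps_add.
Proof. by move=> f g h; apply: fpsP => n /=; rewrite addrA. Qed.
Fact fps_addC : commutative fps_add.
Proof. by move=> f g; apply: fpsP => n /=; rewrite addrC. Qed.
Fact fps_add0 : left_id fps_zero fps_add.
Proof. by move=> f; apply: fpsP => n /=; rewrite add0r. Qed.
Fact fps_addN : left_inverse fps_zero fps_opp fps_add.
Proof. by move=> f; apply: fpsP => n /=; rewrite addNr. Qed.

HB.instance Definition _ := GRing.isZmodule.Build (fps A)
  fps_addA fps_addC fps_add0 fps_addN.

Lemma fps_coef0 n : (0 : fps A) n = 0. Proof. by []. Qed.
Lemma fps_coefD f g n : (f + g) n = f n + g n. Proof. by []. Qed.
Lemma fps_coefN f n : (- f) n = - f n. Proof. by []. Qed.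
Lemma fps_coefB f g n : (f - g) n = f n - g n. Proof. by []. Qed.
Lemma fps_coef_sum (I : Type) (r : seq I) (P : pred I) (F : I -> fps A) n :
  (\sum_(i <- r | P i) F i) n = \sum_(i <- r | P i) F i n.
Proof. exact: (big_morph (fun f : fps A => f n) (fun f g => fps_coefD f g n)). Qed.

End FpsZmod.

Section FpsRing.
Variable A : comNzRingType.
Implicit Types f g h : fps A.

Definition fpsC (c : A) : fps A := Fps (fun n => if n == 0%N then c else 0).
Definition fpsX : fps A := Fps (fun n => (n == 1%N)%:R).
Definition fps_mul f g : fps A :=
  Fps (fun n => \sum_(i < n.+1) f i * g (n - i)%N).

Fact fps_mulC : commutative fps_mul.
Proof.
move=> f g; apply: fpsP => n /=; rewrite (reindex_inj rev_ord_inj) /=.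
by apply: eq_bigr => i _; rewrite mulrC subSS subKn // -ltnS.
Qed.

Fact fps_mulA : associative fps_mul.
Proof.
move=> f g h; rewrite [in RHS]fps_mulC; apply: fpsP => i /=.
pose coef3 j k := f j * (g (i - j - k)%N * h k).
transitivity (\sum_(j < i.+1) \sum_(k < i.+1 | (k <= i - j)%N) coef3 j k).
  apply: eq_bigr => /= j _.
  have -> : \sum_(k < (i - j).+1) g k * h (i - j - k)%N
    = (fps_mul h g) (i - j)%N by rewrite fps_mulC.
  rewrite /= big_distrr /= (big_ord_narrow_leq (leq_subr _ _)).
  by apply: eq_bigr => k _; rewrite /coef3 [h _ * _]mulrC.
rewrite (exchange_big_dep predT) //=; apply: eq_bigr => k _.
transitivity (\sum_(j < i.+1 | (j <= i - k)%N) coef3 j k).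
  apply: eq_bigl => j; rewrite -ltnS -(ltnS j) -!subSn ?leq_ord //.
  by rewrite -subn_gt0 -(subn_gt0 j) -!subnDA addnC.
rewrite (big_ord_narrow_leq (leq_subr _ _)) mulrC big_distrl /=.
by apply: eq_bigr => j _; rewrite /coef3 -!subnDA addnC mulrA.
Qed.

Fact fps_mul1 : left_id (fpsC 1) fps_mul.
Proof.
move=> f; apply: fpsP => n /=; rewrite big_ord_recl /= mul1r subn0.
by rewrite big1 ?addr0 // => i _; rewrite mul0r.
Qed.

Fact fps_mulDl : left_distributive fps_mul +%R.
Proof.
move=> f g h; apply: fpsP => n /=; rewrite -big_split.
by apply: eq_bigr => i _; rewrite mulrDl.
Qed.

Fact fps_one_neq0 : fpsC 1 != 0 :> fps A.
Proof.
apply/eqP => /(congr1 (fun f : fps A => f 0%N)) /= /eqP.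
by rewrite oner_eq0.
Qed.

HB.instance Definition _ := GRing.Zmodule_isComNzRing.Build (fps A)
  fps_mulA fps_mulC fps_mul1 fps_mulDl fps_one_neq0.

Lemma fps_coefC c n : fpsC c n = if n == 0%N then c else 0. Proof. by []. Qed.
Lemma fps_coef1 n : (1 : fps A) n = (n == 0%N)%:R.
Proof. by rewrite -[LHS]/(fpsC 1 n) /=; case: n. Qed.
Lemma fps_coefM f g n : (f * g) n = \sum_(i < n.+1) f i * g (n - i)%N.
Proof. by []. Qed.
Lemma fps_coef0M f g : (f * g) 0%N = f 0%N * g 0%N.
Proof. by rewrite fps_coefM big_ord_recl big_ord0 addr0. Qed.

Lemma fps_coefXM f n : (fpsX * f) n = if n is m.+1 then f m else 0.
Proof.
rewrite fps_coefM big_ord_recl /= mul0r add0r; case: n => [|n].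
  by rewrite big_ord0.
rewrite big_ord_recl /= mul1r subSS subn0 big1 ?addr0 // => i _.
by rewrite mul0r.
Qed.

Lemma fps_coefXnM d f n :
  (fpsX ^+ d * f) n = if (n < d)%N then 0 else f (n - d)%N.
Proof.
elim: d n => [|d IHd] n; first by rewrite expr0 mul1r ltn0 subn0.
by rewrite exprS -mulrA fps_coefXM; case: n => // n; rewrite IHd.
Qed.

Lemma fps_coefX_small f m n : f 0%N = 0 -> (n < m)%N -> (f ^+ m) n = 0.
Proof.
move=> f0; elim: m n => // m IHm n ltnm; rewrite exprS fps_coefM.
rewrite big_ord_recl f0 mul0r add0r big1 // => i _.
by rewrite IHm ?mulr0 //=; case: n ltnm i => [|n] ltnm [i /= lti] //;
  rewrite subSS (leq_ltn_trans (leq_subr _ _)).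
Qed.

(* The substitution f(g(t)), meaningful when g has zero constant term: then
   g^m contributes nothing to the coefficient of t^n for m > n. *)
Definition fps_comp f g : fps A :=
  Fps (fun n => \sum_(m < n.+1) f m * (g ^+ m) n).

(* f / t^d, forgetting the coefficients of degree less than d. *)
Definition fps_shift (d : nat) f : fps A := Fps (fun n => f (n + d)%N).

Lemma fps_shiftK d f : (forall n, (n < d)%N -> f n = 0) ->
  fpsX ^+ d * fps_shift d f = f.
Proof.
move=> f0; apply: fpsP => n; rewrite fps_coefXnM.
by case: ltnP => [/f0//|le_dn] /=; rewrite subnK.
Qed.

(* The order of vanishing at t = 0; conventionally 0 for the zero series. *)
Definition fps_ord f : nat :=
  if pselect (exists n, f n != 0) is left h then ex_minn h else 0%N.

Lemma fps_ord_lt f n : (n < fps_ord f)%N -> f n = 0.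
Proof.
rewrite /fps_ord; case: pselect => // h; case: ex_minnP => m _ mP ltnm.
by apply/eqP; apply: contraTT ltnm => /mP; rewrite -leqNgt.
Qed.

Lemma fps_ordE f d : (forall n, (n < d)%N -> f n = 0) -> f d != 0 ->
  fps_ord f = d.
Proof.
move=> f0 fd; rewrite /fps_ord; case: pselect => [h|[]]; last by exists d.
case: ex_minnP => m fm mP; apply/eqP; rewrite eqn_leq mP // leqNgt.
by apply: contra fm => /f0 ->.
Qed.

End FpsRing.

Arguments fpsX {A}.

Section FpsUnit.
Variable A : comUnitRingType.
Implicit Types f g : fps A.

Definition fps_unit : {pred fps A} := [pred f : fps A | f 0%N \is a GRing.unit].

(* 1/f = f(0)^-1 * sum_m (1 - f/f(0))^m when f(0) is invertible. *)
Definition fps_inv f : fps A :=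
  if f 0%N \is a GRing.unit then
    fpsC (f 0%N)^-1 * fps_comp (Fps (fun _ => 1)) (1 - fpsC (f 0%N)^-1 * f)
  else f.

Lemma fps_geomM (u : fps A) : u 0%N = 0 ->
  (1 - u) * fps_comp (Fps (fun _ => 1)) u = 1.
Proof.
move=> u0; apply: fpsP => n.
transitivity (((1 - u) * (\sum_(m < n.+1) u ^+ m)) n); last first.
  rewrite -(opprB u 1) mulNr -subrX1 opprB fps_coefB.
  by rewrite fps_coefX_small ?subr0.
rewrite !fps_coefM; apply: eq_bigr => i _; congr (_ * _).
rewrite fps_coef_sum /= (big_ord_widen n.+1 (fun m => 1 * (u ^+ m) (n - i)%N)).
  rewrite [RHS](bigID (fun m : 'I_n.+1 => (m < (n - i).+1)%N)) /=.
  rewrite [X in _ = _ + X]big1 ?addr0; first by apply: eq_bigr => m _; rewrite mul1r.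
  by move=> m; rewrite -leqNgt => /fps_coefX_small ->.
by rewrite ltnS leq_subr.
Qed.

Fact fps_mulV : {in fps_unit, left_inverse 1 fps_inv *%R}.
Proof.
move=> f; rewrite inE => f0; rewrite /fps_inv f0.
set u := 1 - _; have u0 : u 0%N = 0.
  by rewrite /u fps_coefB fps_coef0M /= mulVr // subrr.
rewrite mulrAC mulrC -[fpsC _ * f](subKr 1) -/u mulrC; exact: fps_geomM.
Qed.

Fact fps_unitP f g : g * f = 1 -> fps_unit f.
Proof.
move=> /(congr1 (fun h : fps A => h 0%N)); rewrite fps_coef0M fps_coef1 /=.
by move=> gf1; apply/unitrP; exists (g 0%N); rewrite mulrC [f 0%N * _]mulrC.
Qed.

Fact fps_inv_out : {in [predC fps_unit], fps_inv =1 id}.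
Proof. by move=> f; rewrite !inE /fps_inv => /negbTE ->. Qed.

HB.instance Definition _ := GRing.ComNzRing_hasMulInverse.Build (fps A)
  fps_mulV fps_unitP fps_inv_out.

Lemma fps_unitE f : (f \is a GRing.unit) = (f 0%N \is a GRing.unit).
Proof. by []. Qed.

(* f / g in the field of Laurent series, when g does not vanish at t = 0 to a
   higher order than f; the ring inverse only covers the order-0 case. *)
Definition fps_div f g : fps A :=
  fps_shift (fps_ord g) f / fps_shift (fps_ord g) g.

Lemma fps_divK f g :
  (forall n, (n < fps_ord g)%N -> f n = 0) ->
  g (fps_ord g) \is a GRing.unit -> fps_div f g * g = f.
Proof.
move=> f0 gu; rewrite -{2}(fps_shiftK (@fps_ord_lt _ g)) /fps_div.
by rewrite mulrCA divrK ?fps_shiftK // fps_unitE /= add0n.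
Qed.

(* e^{a t} *)
Definition fps_exp (a : A) : fps A := Fps (fun n => a ^+ n / n`!%:R).

End FpsUnit.

Definition fps_map (A B : Type) (h : A -> B) (f : fps A) : fps B :=
  Fps (fun n => h (f n)).

Section Polynomials.
Variable K : fieldType.

Definition polylog (k : int) : fps K :=
  Fps (fun m => if m == 0%N then 0 else (m%:R ^ k)^-1).

(* Li_k(1 - e^{-t}) / (1 - e^{-t}) *)
Definition polyBernoulli_factor (k : int) : fps K :=
  let u := 1 - fps_exp (-1) in fps_div (fps_comp (polylog k) u) u.

(* t^r / prod_j (e^{a_j t} - 1) *)
Definition Barnes_factor (r : nat) (a : 'I_r -> K) : fps K :=
  fps_div (fpsX ^+ r) (\prod_(j < r) (fps_exp (a j) - 1)).

Lemma fps_exp_coef0 (a : K) : fps_exp a 0%N = 1.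
Proof. by rewrite /= expr0 divr1. Qed.

Lemma fps_exp_coef1 (a : K) : fps_exp a 1%N = a.
Proof. by rewrite /= expr1 divr1. Qed.

Lemma polyBernoulli_factorK k :
  polyBernoulli_factor k * (1 - fps_exp (-1))
  = fps_comp (polylog k) (1 - fps_exp (-1)).
Proof.
rewrite /polyBernoulli_factor; set u := 1 - _.
have u0 : u 0%N = 0 by rewrite fps_coefB fps_exp_coef0 fps_coef1 subrr.
have u1 : u 1%N = 1 by rewrite fps_coefB fps_exp_coef1 fps_coef1 sub0r opprK.
have ou : fps_ord u = 1%N.
  by apply: fps_ordE => [[]//|]; rewrite u1 oner_neq0.
apply: fps_divK; rewrite ou ?u1 ?unitr1 // => -[] // _ /=.
by rewrite big_ord_recl big_ord0 mul0r addr0.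
Qed.

Lemma Barnes_factorK r (a : 'I_r -> K) : (forall j, a j != 0) ->
  Barnes_factor a * (\prod_(j < r) (fps_exp (a j) - 1)) = fpsX ^+ r.
Proof.
move=> a0; rewrite /Barnes_factor; set P := \prod_(j < r) _.
have PE : P = fpsX ^+ r * \prod_(j < r) fps_shift 1 (fps_exp (a j) - 1).
  rewrite -[X in fpsX ^+ X]card_ord -prodr_const -big_split /=.
  apply: eq_bigr => j _; rewrite -[fpsX]expr1 fps_shiftK // => -[] // _.
  by rewrite fps_coefB fps_exp_coef0 fps_coef1 subrr.
have Pr : P r = \prod_(j < r) a j.
  rewrite PE fps_coefXnM ltnn subnn.
  rewrite (big_morph (fun f : fps K => f 0%N) (@fps_coef0M K) (fps_coef1 _ 0)).
  apply: eq_bigr => j _.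
  by rewrite -[LHS]/((fps_exp (a j) - 1) 1%N) fps_coefB fps_exp_coef1 fps_coef1 subr0.
have Pr0 : P r != 0 by rewrite Pr; apply/prodf_neq0.
have Plt n : (n < r)%N -> P n = 0 by rewrite PE fps_coefXnM => ->.
have oP := fps_ordE Plt Pr0; apply: fps_divK; rewrite oP ?unitfE //.
by move=> n ltnr; rewrite -[fpsX ^+ r]mulr1 fps_coefXnM ltnr.
Qed.

Lemma FrobeniusEuler_factorK (lambda : K) : lambda != 1 ->
  fps_div (fpsC (1 - lambda)) (fps_exp 1 - fpsC lambda)
    * (fps_exp 1 - fpsC lambda) = fpsC (1 - lambda).
Proof.
move=> l1; set g := fps_exp 1 - _.
have g0 : g 0%N = 1 - lambda by rewrite fps_coefB fps_exp_coef0.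
have g00 : g 0%N != 0 by rewrite g0 subr_eq0 eq_sym.
have og : fps_ord g = 0%N by apply: fps_ordE.
by apply: fps_divK; rewrite og ?unitfE.
Qed.

(* The n-th polynomial P_n with g(t) e^{xt} = sum_n P_n(x) t^n / n!, the
   identity being read in K[x][[t]]. *)
Definition Appell (g : fps K) (n : nat) : {poly K} :=
  n`!%:R *: (fps_map polyC g * fps_exp 'X) n.

Definition S_poly (r : nat) (k : int) (a : 'I_r -> K) (n : nat) : {poly K} :=
  Appell (Barnes_factor a * polyBernoulli_factor k) n.

Definition FrobeniusEuler (s : nat) (lambda : K) (n : nat) : {poly K} :=
  Appell (fps_div (fpsC (1 - lambda)) (fps_exp 1 - fpsC lambda) ^+ s) n.

End Polynomials.

(* Main.v *)
Require Import Defs.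
From HB Require Import structures.
From mathcomp Require Import all_boot all_order all_algebra.
From mathcomp Require Import complex.
From mathcomp Require Import boolp reals.
From mathcomp Require Import ring.
Import GRing.Theory.
Local Open Scope ring_scope.

(** Put [G = (e^t - lambda)^s / (1 - lambda)^s], the inverse of the generating
    series [H] of the Frobenius-Euler polynomials.  Any Appell series factors
    as [g e^{xt} = (g G) (H e^{xt})], so comparing coefficients expands the
    Appell polynomials of [g] in those of [H] with the coefficients of [g G];
    the binomial expansion of [G] in powers of [e^t] turns the latter into
    values [P_{n-m}(j)] of the Appell polynomials of [g]. *)

Lemma fps_coefMn (A : zmodType) (f : fps A) c n : (f *+ c) n = f n *+ c.
Proof. by elim: c => // c IHc; rewrite !mulrS fps_coefD IHc. Qed.

Lemma fps_mapM (A B : comNzRingType) (h : {rmorphism A -> B}) (f g : fps A) :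
  fps_map h (f * g) = fps_map h f * fps_map h g.
Proof.
apply: fpsP => n; rewrite fps_coefM /= rmorph_sum.
by apply: eq_bigr => i _; rewrite rmorphM.
Qed.

Lemma fps_coefCM (A : comNzRingType) (c : A) (f : fps A) n :
  (fpsC c * f) n = c * f n.
Proof.
rewrite fps_coefM big_ord_recl /= subn0 big1 ?addr0 // => i _.
by rewrite mul0r.
Qed.

Lemma fpsCM (A : comNzRingType) (c d : A) : fpsC (c * d) = fpsC c * fpsC d.
Proof. by apply: fpsP => n; rewrite fps_coefCM /=; case: eqP; rewrite ?mulr0. Qed.

Lemma fpsCX (A : comNzRingType) (c : A) n : fpsC (c ^+ n) = fpsC c ^+ n.
Proof. by elim: n => // n IHn; rewrite !exprS fpsCM IHn. Qed.

Lemma fpsCN (A : comNzRingType) (c : A) : fpsC (- c) = - fpsC c.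
Proof. by apply: fpsP => n /=; case: eqP; rewrite ?oppr0. Qed.

(** Evaluation at a point is a ring morphism, so it acts on [g e^{xt}] coefficient by coefficient;
    it is used at the integers [j]. *)
Lemma horner_Appell (K : fieldType) (g : fps K) n (x : K) :
  (Appell g n).[x] = n`!%:R * (g * fps_exp x) n.
Proof.
rewrite /Appell hornerZ !fps_coefM horner_sum; congr (_ * _).
apply: eq_bigr => i _ /=; rewrite hornerM hornerC hornerM hornerXn.
(* The factorial is inverted in [{poly K}]; it must be recognised as a constant to be evaluated. *)
by rewrite -polyC_natr polyCV hornerC.
Qed.

Section CharacteristicZero.
Variable K : fieldType.
Hypothesis pcharK0 : [pchar K] =i pred0.

Lemma fact_neq0 n : n`!%:R != 0 :> K.
Proof. by move/pcharf0P: pcharK0 => ->; rewrite -lt0n fact_gt0. Qed.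

Lemma natr_binE n m : (m <= n)%N ->
  'C(n, m)%:R = n`!%:R / (m`!%:R * (n - m)`!%:R) :> K.
Proof.
by move=> le_mn; rewrite -(bin_fact le_mn) !natrM mulfK // mulf_neq0 ?fact_neq0.
Qed.

(** The binomial theorem divided by [n!]; characteristic zero makes the factorials invertible. *)
Lemma fps_expD (a b : K) : fps_exp (a + b) = fps_exp a * fps_exp b.
Proof.
(* After the swap [exprDn] gives [a] the exponent [i], as in the Cauchy product. *)
apply: fpsP => n; rewrite fps_coefM /= addrC exprDn mulr_suml.
apply: eq_bigr => i _; have le_in : (i <= n)%N by rewrite -ltnS.
rewrite -mulr_natr natr_binE //.
by field; rewrite !fact_neq0.
Qed.

Lemma fps_expX (j : nat) : fps_exp 1 ^+ j = fps_exp j%:R :> fps K.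
Proof.
elim: j => [|j IHj]; last by rewrite exprS IHj -fps_expD -natr1 addrC.
apply: fpsP => n; rewrite fps_coef1 /= expr0n.
by case: n => [|n]; rewrite ?divr1 ?mul0r.
Qed.

(** This is the Cauchy product of [f] with [g e^{xt}], rescaled by [n! = 'C(n, m) m! (n - m)!]. *)
Lemma AppellM (f g : fps K) n :
  Appell (f * g) n =
    \sum_(m < n.+1) ('C(n, m)%:R * ((n - m)`!%:R * f (n - m)%N)) *: Appell g m.
Proof.
rewrite /Appell fps_mapM -mulrA mulrC fps_coefM scaler_sumr.
apply: eq_bigr => m _; have le_mn : (m <= n)%N by rewrite -ltnS.
rewrite [_ * fps_map _ _ _]mulrC /= mul_polyC !scalerA; congr (_ *: _).
by rewrite -(bin_fact le_mn) !natrM; ring.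
Qed.

Lemma Appell_FrobeniusEuler (g : fps K) s (lambda : K) n : lambda != 1 ->
  Appell g n =
    \sum_(m < n.+1)
      ('C(n, m)%:R / (1 - lambda) ^+ s *
        \sum_(j < s.+1)
          'C(s, j)%:R * (- lambda) ^+ (s - j) * (Appell g (n - m)).[j%:R])
      *: FrobeniusEuler s lambda m.
Proof.
move=> l1; set H := fps_div (fpsC (1 - lambda)) (fps_exp 1 - fpsC lambda).
have l10 : (1 - lambda) ^+ s != 0 by rewrite expf_neq0 // subr_eq0 eq_sym.
pose G := fpsC ((1 - lambda) ^+ s)^-1 * (fps_exp 1 - fpsC lambda) ^+ s.
have GH : G * H ^+ s = 1.
  rewrite /G -mulrA -exprMn [_ * H]mulrC FrobeniusEuler_factorK //.
  by rewrite -fpsCX -fpsCM mulVf.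
(* [Appell (H ^+ s) m] is [FrobeniusEuler s lambda m] by definition, so only the coefficients of
   [g * G] remain. *)
rewrite -{1}[g]mulr1 -GH mulrA AppellM; apply: eq_bigr => m _.
congr (_ *: _); rewrite -mulrA; congr (_ * _).
rewrite /G [g * _]mulrCA fps_coefCM mulrCA; congr (_ * _).
(* With [- lambda] in front, the index [j] of [exprDn] counts the powers of [e^t]. *)
rewrite addrC -fpsCN exprDn [g * _]mulr_sumr fps_coef_sum mulr_sumr.
apply: eq_bigr => j _; rewrite horner_Appell fps_expX -fpsCX.
rewrite mulrnAr fps_coefMn mulrCA fps_coefCM -mulr_natl.
by ring.
Qed.

End CharacteristicZero.

Theorem theorem8 (R : realType) (r s : nat) (k : int) (a : 'I_r -> R[i])
    (lambda : R[i]) (hr : (0 < r)%N) (ha : forall j : 'I_r, a j != 0)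
    (hlambda : lambda != 1) (n : nat) :
  S_poly k a n =
    \sum_(0 <= m < n.+1)
      ('C(n, m)%:R / (1 - lambda) ^+ s *
        \sum_(0 <= j < s.+1)
          'C(s, j)%:R * (- lambda) ^+ (s - j) * (S_poly k a (n - m)).[j%:R])
      *: FrobeniusEuler s lambda m.
Proof.
rewrite big_mkord /S_poly.
rewrite {1}(Appell_FrobeniusEuler _ (Num.Theory.pchar_num _) _ s _ _ hlambda).
by apply: eq_bigr => m _; rewrite big_mkord.
Qed.
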